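(* For any given ensemble $\mathfrak E=\{p_i,\psi_i\}_i$ of pure states and any $\epsilon\ge0$, $$\max_{\overline{\mathfrak E}\in b(\mathfrak E,\epsilon)}F^{\Delta}_{\min}(\overline{\mathfrak E})-\delta\;\le\; C_c(\mathfrak E,\epsilon)\;\le\;\max_{\overline{\mathfrak E}\in b(\mathfrak E,2\epsilon)}F^{\Delta}_{\min}(\overline{\mathfrak E}),$$ where $0\le\delta\le1$ is a number to ensure that the lower limit is the (base-2) logarithm of an integer.
   Context: All Hilbert spaces are finite-dimensional and each carries a fixed orthonormal ''incoherent'' basis $\{|i\rangle\}$. For a unit vector $|\psi\rangle$ write $\psi=|\psi\rangle\langle\psi|$. A state is incoherent if it is diagonal in the fixed basis. $\Delta(X)=\sum_i |i\rangle\langle i|X|i\rangle\langle i|$ is the dephasing map. The fidelity is $F(\rho,\sigma)=\operatorname{Tr}\sqrt{\sqrt\sigma\rho\sqrt\sigma}$. The min-entropy is $S_{\min}(\rho)=-\log_2\lambda_{\max}(\rho)$, with $\lambda_{\max}(\rho)$ the largest eigenvalue of $\rho$. An incoherent operation $\Lambda$ from $\mathcal H$ to $\mathcal H'$ (each with its incoherent basis) is a completely positive trace-preserving map admitting a Kraus decomposition $\Lambda(X)=\sum_n K_nXK_n^\dagger$ such that, for every $n$ and every incoherent state $\tau$ on $\mathcal H$, $K_n\tau K_n^\dagger$ is diagonal in the incoherent basis of $\mathcal H'$. $|\Phi_M\rangle=\frac1{\sqrt M}\sum_{i=1}^M|i\rangle$ is the maximally coherent state of rank $M$. A pure state ensemble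 $\mathfrak E=\{p_i,\psi_i\}_i$ consists of probabilities $p_i$ with $\sum_ip_i=1$ and pure states $\psi_i$. Its coherence concentration is $$C_c(\mathfrak E,\epsilon):=\max_{M\in\mathbb N}\Big\{\log_2M:\ \max_{\{\Lambda_i\}_i}F^2\Big(\sum_ip_i\Lambda_i(\psi_i),\Phi_M\Big)\ge1-\epsilon\Big\},$$ where the $\Lambda_i$ are incoherent operations. Further, $$F^{\Delta}_{\min}(\mathfrak E):=\min_iS_{\min}(\Delta(\psi_i)),\qquad b(\mathfrak E,\epsilon):=\Big\{\overline{\mathfrak E}=\{p_i,\overline\psi_i\}_i:\ \sum_ip_iF^2(\overline\psi_i,\psi_i)\ge1-\epsilon\Big\},$$ where in $b(\mathfrak E,\epsilon)$ the $p_i$ are the same as in $\mathfrak E$ and the $\overline\psi_i$ are pure states.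
   Formalization: The pure states in b(E,ε) may live in a larger space containing that of the ψ_i (otherwise the upper bound fails, e.g. for Φ_4 in dimension 4 with ε=1/5), and maxima are read as suprema, possibly +∞ when ε≥1. *)

(* Defs.v *)
From HB Require Import structures.
From mathcomp Require Import all_boot all_order all_algebra.
From mathcomp Require Import all_classical all_reals all_analysis.
From mathcomp Require Import complex.

Set Implicit Arguments.
Unset Strict Implicit.
Unset Printing Implicit Defensive.

Import Order.TTheory GRing.Theory Num.Theory.

Local Open Scope classical_set_scope.
Local Open Scope ring_scope.
Local Open Scope complex_scope.
Local Open Scope sesquilinear_scope.

(* A Hilbert space of dimension d is the space of column vectors 'cV[R[i]]_d;
   its incoherent basis is the canonical one, so incoherent means diagonal. *)

Definition log2 (R : realType) (x : R) : R := ln x / ln 2.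

Definition ketbra (R : realType) (d : nat) (psi : 'cV[R[i]]_d) : 'M[R[i]]_d :=
  psi *m psi ^t*.

Definition unit_vector (R : realType) (d : nat) (psi : 'cV[R[i]]_d) : Prop :=
  (psi ^t* *m psi) 0 0 = 1.

Definition psdmx (R : realType) (d : nat) (A : 'M[R[i]]_d) : Prop :=
  A \is hermsymmx /\ forall v : 'cV[R[i]]_d, 0 <= (v ^t* *m A *m v) 0 0.

Definition density_matrix (R : realType) (d : nat) (rho : 'M[R[i]]_d) : Prop :=
  psdmx rho /\ \tr rho = 1.

Definition incoherent_state (R : realType) (d : nat) (rho : 'M[R[i]]_d) : Prop :=
  density_matrix rho /\ is_diag_mx rho.

Definition dephase (R : realType) (d : nat) (X : 'M[R[i]]_d) : 'M[R[i]]_d :=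
  \matrix_(i, j) if i == j then X i j else 0.

(* Functional calculus for the square root, through
   A = invmx (spectralmx A) *m diag_mx (spectral_diag A) *m spectralmx A;
   used only on positive semidefinite matrices. *)
Definition sqrtmx (R : realType) (d : nat) (A : 'M[R[i]]_d) : 'M[R[i]]_d :=
  invmx (spectralmx A) *m diag_mx (map_mx sqrtC (spectral_diag A))
    *m spectralmx A.

(* On positive semidefinite arguments the trace is a nonnegative real. *)
Definition fidelity (R : realType) (d : nat) (rho sigma : 'M[R[i]]_d) : R :=
  complex.Re (\tr (sqrtmx (sqrtmx sigma *m rho *m sqrtmx sigma))).

Definition lambda_max (R : realType) (d : nat) (rho : 'M[R[i]]_d) : R :=
  sup [set x : R | eigenvalue rho x%:C].

Definition Smin (R : realType) (d : nat) (rho : 'M[R[i]]_d) : R :=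
  - log2 (lambda_max rho).

(* Complete positivity is not listed separately: it is equivalent to the
   existence of a Kraus decomposition. *)
Definition incoherent_operation (R : realType) (d d' : nat)
    (L : 'M[R[i]]_d -> 'M[R[i]]_d') : Prop :=
  (forall X, \tr (L X) = \tr X) /\
  exists (N : nat) (K : 'I_N -> 'M[R[i]]_(d', d)),
    (forall X, L X = \sum_(n < N) K n *m X *m (K n) ^t*) /\
    (forall (n : 'I_N) (tau : 'M[R[i]]_d), incoherent_state tau ->
       is_diag_mx (K n *m tau *m (K n) ^t*)).

(* The maximally coherent state of rank M on the first M incoherent basis
   vectors of a space of dimension d >= M. *)
Definition Phi (R : realType) (d M : nat) : 'cV[R[i]]_d :=
  \col_(i < d) if (i < M)%N then ((Num.sqrt M%:R)^-1)%:C else 0.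

Record pure_ensemble (R : realType) (n d : nat) := PureEnsemble {
  prob : 'I_n -> R;
  ket : 'I_n -> 'cV[R[i]]_d;
  prob_ge0 : forall i, 0 <= prob i;
  prob_sum1 : \sum_(i < n) prob i = 1;
  ket_unit : forall i, unit_vector (ket i)
}.

(* The codomain of the operations L i ranges over all spaces that contain
   Phi_M. Maxima are suprema in the extended reals, since the set of
   admissible M is unbounded when eps >= 1. *)
Definition coherence_concentration (R : realType) (n d : nat)
    (E : pure_ensemble R n d) (eps : R) : \bar R :=
  ereal_sup [set x : \bar R | exists M : nat, [/\ (0 < M)%N,
    ((1 - eps)%:E <=
       ereal_sup [set f : \bar R | exists (d' : nat)
           (L : 'I_n -> 'M[R[i]]_d -> 'M[R[i]]_d'),
         [/\ (M <= d')%N, forall i, incoherent_operation (L i) &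
           f = ((fidelity
                   (\sum_(i < n) (prob E i)%:C *: L i (ketbra (ket E i)))
                   (ketbra (Phi R d' M))) ^+ 2)%:E]])%E &
    x = (log2 M%:R)%:E]].

Definition Fmin (R : realType) (n d : nat) (E : pure_ensemble R n d) : R :=
  inf (range (fun i => Smin (dephase (ketbra (ket E i))))).

(* The ensembles close to E may live in a larger space, of dimension d + k,
   in which the given space is spanned by the first d incoherent basis
   vectors. Requiring k = 0 would make the upper bound of the main inequality
   fail: for d = 4, n = 1, ket E = Phi_4 and eps = 1/5, embedding into
   dimension 5 gives F^2(Phi_4, Phi_5) = 4/5, so the concentration is at least
   log2 5, whereas Smin (dephase _) <= log2 4 in dimension 4. *)
Definition embed (R : realType) (d k : nat) (psi : 'cV[R[i]]_d) :
  'cV[R[i]]_(d + k) := col_mx psi 0.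

Definition ball_ensemble (R : realType) (n d k : nat) (E : pure_ensemble R n d)
    (eps : R) (E' : pure_ensemble R n (d + k)) : Prop :=
  prob E' = prob E /\
  1 - eps <= \sum_(i < n) prob E i *
    (fidelity (ketbra (ket E' i)) (ketbra (embed k (ket E i)))) ^+ 2.

(* The supremum is +oo when eps >= 1, since k is arbitrary. *)
Definition smoothed_Fmin (R : realType) (n d : nat) (E : pure_ensemble R n d)
    (eps : R) : \bar R :=
  ereal_sup [set x : \bar R | exists (k : nat) (E' : pure_ensemble R n (d + k)),
    ball_ensemble E eps E' /\ x = (Fmin E')%:E].

(* No rounding is possible, or needed, when x is infinite. *)
Definition rounds_to_log2_integer (R : realType) (x : \bar R) (delta : R) : Prop :=
  0 <= delta <= 1 /\
  (x \is a fin_num ->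
     exists2 N : nat, (0 < N)%N & (x - delta%:E)%E = (log2 N%:R)%:E).

(* Main.v *)
Require Import Defs.
From mathcomp Require Import all_boot all_order all_algebra.
From mathcomp Require Import all_classical all_reals all_analysis.
From mathcomp Require Import complex ring lra.

(* Call a vector u "flat" when |u|^2 <= 1 and |u_j|^2 <= 1/M for all j; these
   are the truncations to the original space of the unit vectors v of a larger
   space with S_min (Delta v) >= log2 M.  For a pure state psi, the best overlap
   <Phi_M|L psi|Phi_M> over incoherent operations L equals the best |<u|psi>|^2
   over flat u:
   - given L with Kraus operators K_n, put a_n = <Phi_M|K_n psi> and
     g = sum_n |a_n|^2; then u = g^(-1/2) sum_n a_n K_n^* Phi_M is flat (by
     Cauchy-Schwarz and incoherence of L) and |<u|psi>|^2 = g;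
   - given u flat, complete it to a unit vector v and write M |v_j|^2, a point of
     the hypersimplex, as a convex combination of indicators of M-sets; each
     M-set gives an incoherent Kraus operator sending v to a multiple of Phi_M.
   Hence the two sides agree up to attainment of suprema.  The slack between eps
   and 2 eps absorbs this when eps > 0; when eps = 0 the flat vectors approach
   psi itself, which is therefore flat. *)

Set Implicit Arguments.
Unset Strict Implicit.
Unset Printing Implicit Defensive.

Import Order.TTheory GRing.Theory Num.Theory.
Local Open Scope ring_scope.
Local Open Scope sesquilinear_scope.

(** * Inner products and fidelity with a pure state *)

Lemma sum_enum_val (V : nmodType) (T : finType) (F : T -> V) :
  \sum_(i < #|T|) F (enum_val i) = \sum_t F t.
Proof. by rewrite [RHS](reindex _ (onW_bij _ (enum_val_bij T))). Qed.

Section Braket.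
Variable C : numClosedFieldType.

Definition braket m (u v : 'cV[C]_m) : C := (u ^t* *m v) 0 0.

Lemma braketE m (u v : 'cV[C]_m) : braket u v = \sum_j (u j 0)^* * v j 0.
Proof. by rewrite /braket mxE; apply: eq_bigr => j _; rewrite !mxE. Qed.

Lemma braket_sqr m (u : 'cV[C]_m) : braket u u = \sum_j `|u j 0| ^+ 2.
Proof. by rewrite braketE; apply: eq_bigr => j _; rewrite normCK mulrC. Qed.

Lemma braket_ge0 m (u : 'cV[C]_m) : 0 <= braket u u.
Proof. by rewrite braket_sqr sumr_ge0 // => j _; rewrite exprn_ge0. Qed.

Lemma adjmxM m n p (A : 'M[C]_(m, n)) (B : 'M[C]_(n, p)) :
  (A *m B) ^t* = B ^t* *m A ^t*.
Proof. by rewrite trmx_mul map_mxM. Qed.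

Lemma adjmxK m n (A : 'M[C]_(m, n)) : A ^t* ^t* = A.
Proof. exact: trmxCK. Qed.

Lemma braketC m (u v : 'cV[C]_m) : braket v u = (braket u v)^*.
Proof.
by rewrite !braketE rmorph_sum; apply: eq_bigr => j _; rewrite rmorphM /= conjCK mulrC.
Qed.

Lemma normC_braketC m (u v : 'cV[C]_m) : `|braket v u| = `|braket u v|.
Proof. by rewrite braketC norm_conjC. Qed.

Lemma braket_mulmx m n (A : 'M[C]_(m, n)) u v :
  braket u (A *m v) = braket (A ^t* *m u) v.
Proof. by rewrite /braket adjmxM adjmxK mulmxA. Qed.

Lemma braket_sumr m (T : finType) (u : 'cV[C]_m) (v : T -> 'cV[C]_m) :
  braket u (\sum_t v t) = \sum_t braket u (v t).
Proof. by rewrite /braket mulmx_sumr summxE. Qed.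

Lemma braketZr m (u v : 'cV[C]_m) a : braket u (a *: v) = a * braket u v.
Proof. by rewrite /braket -scalemxAr mxE. Qed.

Lemma braketZl m (u v : 'cV[C]_m) a : braket (a *: u) v = a^* * braket u v.
Proof. by rewrite braketC braketZr rmorphM /= -braketC. Qed.

Lemma braketBr m (u v w : 'cV[C]_m) : braket u (v - w) = braket u v - braket u w.
Proof. by rewrite /braket mulmxBr !mxE. Qed.

Lemma braketBl m (u v w : 'cV[C]_m) : braket (u - v) w = braket u w - braket v w.
Proof. by rewrite braketC braketBr rmorphB /= -!braketC. Qed.

Lemma braket_col_mx m n (u v : 'cV[C]_m) (u' v' : 'cV[C]_n) :
  braket (col_mx u u') (col_mx v v') = braket u v + braket u' v'.
Proof.
rewrite !braketE big_split_ord /=.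
by congr (_ + _); apply: eq_bigr => j _; rewrite ?col_mxEu ?col_mxEd.
Qed.

Lemma braket_CauchySchwarz m (u v : 'cV[C]_m) :
  `|braket u v| ^+ 2 <= braket u u * braket v v.
Proof.
have := @CauchySchwarz C 'rV[C]_m (@dotmx C m) u^T v^T.
move=> [H _]; move: H.
have E (x y : 'cV[C]_m) : dotmx x^T y^T = braket y x.
  rewrite dotmxE braketE mxE; apply: eq_bigr => j _; by rewrite !mxE mulrC.
by rewrite /= !E normC_braketC.
Qed.

Lemma sum_CauchySchwarz (T : finType) (a b : T -> C) :
  `|\sum_t (a t)^* * b t| ^+ 2 <= (\sum_t `|a t| ^+ 2) * \sum_t `|b t| ^+ 2.
Proof.
have := braket_CauchySchwarz (\col_(i < #|T|) a (enum_val i))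
  (\col_(i < #|T|) b (enum_val i)).
rewrite !braket_sqr braketE.
under eq_bigr do rewrite !mxE.
under [in X in _ <= X * _]eq_bigr do rewrite !mxE.
under [in X in _ <= _ * X]eq_bigr do rewrite !mxE.
by rewrite (sum_enum_val (fun t => (a t)^* * b t))
  (sum_enum_val (fun t => `|a t| ^+ 2)) (sum_enum_val (fun t => `|b t| ^+ 2)).
Qed.

End Braket.

Section Fidelity.
Variable R : realType.
Local Notation C := R[i].
Local Open Scope complex_scope.

Lemma ketbra_proj d (phi : 'cV[C]_d) : unit_vector phi ->
  ketbra phi *m ketbra phi = ketbra phi.
Proof.
move=> phi1; rewrite /ketbra -mulmxA (mulmxA (phi ^t*)) [_ ^t* *m phi]mx11_scalar.
by rewrite phi1 mul1mx.
Qed.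

Lemma ketbra_herm d (phi : 'cV[C]_d) : (ketbra phi) ^t* = ketbra phi.
Proof. by rewrite /ketbra adjmxM adjmxK. Qed.

(** For A = cP the identity A^2 = cA forces every eigenvalue to be 0 or c. If c is nonzero, the
    square root acts on both values as division by [sqrtC c], so the functional calculus returns A /
    [sqrtC c]; if c = 0, everything vanishes. *)
Lemma sqrtmx_scale_proj d (P : 'M[C]_d) (c : C) : 0 <= c ->
  P ^t* = P -> P *m P = P -> sqrtmx (c *: P) = sqrtC c *: P.
Proof.
move=> c0 hP PP; set A := c *: P.
have AE : A ^t* = A.
  by rewrite /A linearZ /= map_mxZ hP /= (CrealP (ger0_real c0)).
have AA : A *m A = c *: A by rewrite /A -scalemxAl -scalemxAr PP.
have nA : A \is normalmx by apply/normalmxP; rewrite AE.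
have := orthomx_spectralP nA; rewrite /sqrtmx.
set U := spectralmx A; set D := spectral_diag A => AD.
have Uu : U \in unitmx := spectral_unit A.
have DE : diag_mx D = U *m A *m invmx U.
  by rewrite {1}AD !mulmxA mulmxV // mul1mx mulmxK.
have DD : diag_mx D *m diag_mx D = c *: diag_mx D.
  rewrite DE !mulmxA mulmxKV // -(mulmxA U A A) AA -scalemxAr.
  by rewrite -scalemxAl.
have Dj j : D 0 j * D 0 j = c * D 0 j.
  by have /matrixP/(_ j j) := DD; rewrite mulmx_diag !mxE eqxx !mulr1n.
have -> : map_mx sqrtC D = (sqrtC c)^-1 *: D.
  apply/rowP => j; rewrite !mxE.
  have [->|D0] := eqVneq (D 0 j) 0; first by rewrite sqrtC0 mulr0.
  have -> : D 0 j = c by apply: (mulIf D0).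
  have [->|c00] := eqVneq c 0; first by rewrite sqrtC0 mulr0.
  by rewrite -{3}(sqrtCK c) expr2 mulKf // sqrtC_eq0.
rewrite linearZ /= -scalemxAr -scalemxAl -AD /A scalerA; congr (_ *: _).
have [->|c00] := eqVneq c 0; first by rewrite sqrtC0 mulr0.
by rewrite -{2}(sqrtCK c) expr2 mulKf // sqrtC_eq0.
Qed.

(** With P the projector on [phi], P rho P = <phi|rho|phi> P, and the root of this multiple of P has
    trace sqrt <phi|rho|phi>. *)
Lemma fidelity_pure d (rho : 'M[C]_d) (phi : 'cV[C]_d) : unit_vector phi ->
  0 <= braket phi (rho *m phi) ->
  ((fidelity rho (ketbra phi)) ^+ 2)%:C = braket phi (rho *m phi).
Proof.
move=> phi1 r0.
have P := sqrtmx_scale_proj ler01 (ketbra_herm phi) (ketbra_proj phi1).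
rewrite scale1r sqrtC1 scale1r in P.
rewrite /fidelity P.
have -> : ketbra phi *m rho *m ketbra phi = braket phi (rho *m phi) *: ketbra phi.
  rewrite /ketbra /braket.
  have -> : phi *m phi ^t* *m rho *m (phi *m phi ^t*) =
    phi *m (phi ^t* *m (rho *m phi)) *m phi ^t* by rewrite !mulmxA.
  by rewrite [X in phi *m X *m _]mx11_scalar mul_mx_scalar -scalemxAl.
rewrite (sqrtmx_scale_proj r0 (ketbra_herm phi) (ketbra_proj phi1)) mxtraceZ.
have -> : \tr (ketbra phi) = 1.
  by rewrite /ketbra mxtrace_mulC [_ *m _]mx11_scalar phi1 mxtrace1.
have s0 : 0 <= sqrtC (braket phi (rho *m phi)) by rewrite sqrtC_ge0.
by rewrite mulr1 rmorphXn /= RRe_real ?ger0_real // sqrtCK.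
Qed.

Lemma braket_ketbra d (v phi : 'cV[C]_d) :
  braket phi (ketbra v *m phi) = `|braket phi v| ^+ 2.
Proof.
have -> : ketbra v *m phi = braket v phi *: v.
  by rewrite /ketbra -mulmxA [_ *m phi]mx11_scalar mul_mx_scalar.
by rewrite braketZr normCK -braketC mulrC.
Qed.

Lemma fidelity_ketbra d (v phi : 'cV[C]_d) : unit_vector phi ->
  ((fidelity (ketbra v) (ketbra phi)) ^+ 2)%:C = `|braket phi v| ^+ 2.
Proof.
by move=> phi1; rewrite fidelity_pure // braket_ketbra // exprn_ge0.
Qed.

Lemma mulmx_ketbra d d' (K : 'M[C]_(d', d)) (psi : 'cV[C]_d) :
  K *m ketbra psi *m K ^t* = ketbra (K *m psi).
Proof. by rewrite /ketbra adjmxM !mulmxA. Qed.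

End Fidelity.

(** * From incoherent operations to flat vectors *)

Section Converse.
Variable R : realType.
Local Notation C := R[i].
Local Open Scope complex_scope.

Definition flat M d (u : 'cV[C]_d) : Prop :=
  braket u u <= 1 /\ forall j, `|u j 0| ^+ 2 <= M%:R^-1.

Lemma normCr (x : R) : `|x%:C| = `|x|%:C :> C.
Proof. by rewrite normc_def /= expr0n addr0 sqrtr_sqr. Qed.

Lemma sqr_invsqrt_nat (M : nat) :
  (((Num.sqrt M%:R)^-1)%:C ^+ 2 : C) = M%:R^-1.
Proof.
by rewrite -rmorphXn exprVn sqr_sqrtr // fmorphV rmorph_nat.
Qed.

Lemma Phi_norm2 d M (j : 'I_d) :
  `|Phi R d M j 0| ^+ 2 = (if (j < M)%N then M%:R^-1 else 0) :> C.
Proof.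
rewrite mxE; case: ifP => _; last by rewrite normr0 expr0n.
by rewrite normCr ger0_norm ?invr_ge0 ?sqrtr_ge0 // sqr_invsqrt_nat.
Qed.

Lemma Phi_unit d M : (0 < M)%N -> (M <= d)%N -> unit_vector (Phi R d M).
Proof.
move=> M0 Md; rewrite /unit_vector -[LHS]/(braket _ _) braket_sqr.
under eq_bigr do rewrite Phi_norm2.
rewrite -big_mkcond /= (big_ord_narrow Md) /= sumr_const card_ord -[LHS]mulr_natl.
by rewrite divff // pnatr_eq0 -lt0n.
Qed.

(** Only the terms |Phi_j|^2 X_jj survive, and each weight |Phi_j|^2 is at most 1/M. *)
Lemma Phi_diag_le d M (X : 'M[C]_d) : is_diag_mx X -> (forall j, 0 <= X j j) ->
  braket (Phi R d M) (X *m Phi R d M) <= M%:R^-1 * \tr X.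
Proof.
move=> /is_diag_mxP dX X0; rewrite braketE /mxtrace mulr_sumr ler_sum // => j _.
rewrite [(X *m _) j 0]mxE (bigD1 j) //= big1 => [|k kj]; last first.
  by rewrite dX ?mul0r // eq_sym.
rewrite addr0 mulrCA -[X in _ * X]mulrC -normCK Phi_norm2 mulrC.
by rewrite ler_wpM2r //; case: ifP => // _; rewrite invr_ge0.
Qed.

Lemma mxtrace_ketbra d (x : 'cV[C]_d) : \tr (ketbra x) = braket x x.
Proof. by rewrite /ketbra mxtrace_mulC /mxtrace big_ord1. Qed.

Lemma ketbra_delta d (j : 'I_d) :
  ketbra (delta_mx j 0 : 'cV[C]_d) = delta_mx j j.
Proof. by rewrite /ketbra trmx_delta map_delta_mx mul_delta_mx. Qed.

Lemma incoherent_delta d (j : 'I_d) : incoherent_state (delta_mx j j : 'M[C]_d).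
Proof.
have tr1 : \tr (delta_mx j j : 'M[C]_d) = 1.
  rewrite /mxtrace (bigD1 j) //= mxE !eqxx big1 ?addr0 // => k kj.
  by rewrite mxE (negPf kj).
split; [split; [split |] |] => //.
- by apply/is_hermitianmxP; rewrite expr0 scale1r -ketbra_delta ketbra_herm.
- move=> v; rewrite -mulmxA -[leRHS]/(braket v _) -ketbra_delta braket_ketbra.
  by rewrite exprn_ge0.
- apply/is_diag_mxP => a b ab; rewrite mxE.
  by case: eqP => // aj; case: eqP => // bj; rewrite aj bj eqxx in ab.
Qed.

(** Let Q(x) be the overlap of L(|x><x|) with [phi]. Cauchy-Schwarz over the Kraus index gives
    |<w|x>|^2 <= g Q(x): x = w bounds the norm of [w], basis vectors x bound its entries, and
    <w|psi> = g. *)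
Lemma incoherent_flat d d' (L : 'M[C]_d -> 'M[C]_d') M (psi : 'cV[C]_d) :
  incoherent_operation L -> (0 < M)%N -> (M <= d')%N ->
  exists2 u, flat M u &
    braket (Phi R d' M) (L (ketbra psi) *m Phi R d' M) = `|braket u psi| ^+ 2.
Proof.
move=> [trL [N [K [LK incK]]]] M0 Md; set phi := Phi R d' M.
have phi1 : braket phi phi = 1 by apply: Phi_unit.
have QE (x : 'cV_d) : braket phi (L (ketbra x) *m phi) =
    \sum_n `|braket phi (K n *m x)| ^+ 2.
  rewrite LK mulmx_suml braket_sumr; apply: eq_bigr => n _.
  by rewrite mulmx_ketbra braket_ketbra.
have Qle (x : 'cV_d) : braket phi (L (ketbra x) *m phi) <= braket x x.
  rewrite QE -mxtrace_ketbra -trL LK raddf_sum ler_sum //= => n _.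
  rewrite mulmx_ketbra mxtrace_ketbra.
  by have := braket_CauchySchwarz phi (K n *m x); rewrite phi1 mul1r.
(* Incoherence of [L] enters here: a basis state is sent to a diagonal matrix of trace 1. *)
have Qdelta j : braket phi (L (ketbra (delta_mx j 0)) *m phi) <= M%:R^-1.
  have [[_ tr1] _] := incoherent_delta j.
  have -> : M%:R^-1 = M%:R^-1 * \tr (L (delta_mx j j)) by rewrite trL tr1 mulr1.
  rewrite ketbra_delta; apply: Phi_diag_le.
    rewrite LK; apply/is_diag_mxP => a b ab; rewrite summxE big1 // => n _.
    by have /is_diag_mxP -> := incK n _ (incoherent_delta j).
  move=> a; rewrite LK summxE sumr_ge0 // => n _.
  rewrite -ketbra_delta mulmx_ketbra /ketbra mxE big_ord1 !mxE -normCK.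
  by rewrite exprn_ge0.
pose a n := braket phi (K n *m psi).
set g := braket phi (L (ketbra psi) *m phi).
have gE : g = \sum_n `|a n| ^+ 2 by rewrite /g QE.
have g0 : 0 <= g by rewrite gE sumr_ge0 // => n _; rewrite exprn_ge0.
pose w := \sum_n a n *: ((K n) ^t* *m phi).
have wE x : braket w x = \sum_n (a n)^* * braket phi (K n *m x).
  rewrite braketC braket_sumr rmorph_sum; apply: eq_bigr => n _.
  by rewrite braketZr rmorphM /= -braketC braket_mulmx.
have wle x : `|braket w x| ^+ 2 <= g * braket phi (L (ketbra x) *m phi).
  by rewrite wE gE QE; apply: sum_CauchySchwarz.
(* With x = w: |w|^4 <= g Q(w) <= g |w|^2, then division by |w|^2. *)
have ww : braket w w <= g.
  have [->//|w0] := eqVneq (braket w w) 0.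
  have wp : 0 < braket w w by rewrite lt_def w0 braket_ge0.
  rewrite -(ler_pM2r wp) -{1}(ger0_norm (ltW wp)) -{2}(ger0_norm (ltW wp)) -expr2.
  by apply: le_trans (wle w) _; rewrite ler_wpM2l.
have sg2 : `|(sqrtC g)^-1| ^+ 2 = g^-1.
  by rewrite ger0_norm ?invr_ge0 ?sqrtC_ge0 // exprVn sqrtCK.
(* For g = 0 the inverse is 0 by convention, and the witness below is the zero vector. *)
have gV1 : g^-1 * g <= 1.
  by have [->|gn0] := eqVneq g 0; rewrite ?mulr0 ?ler01 // mulVf.
exists ((sqrtC g)^-1 *: w); first split.
- rewrite braketZr braketZl mulrA -normCK sg2.
  by apply: le_trans gV1; rewrite ler_wpM2l ?invr_ge0.
- move=> j; rewrite mxE normrM exprMn sg2.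
  have -> : `|w j 0| = `|braket w (delta_mx j 0)|.
    rewrite braketE (bigD1 j) //= !mxE eqxx mulr1 big1 ?addr0 ?norm_conjC //.
    by move=> k kj; rewrite mxE (negPf kj) mulr0.
  apply: (@le_trans _ _ (g^-1 * (g * M%:R^-1))).
    rewrite ler_wpM2l ?invr_ge0 //; apply: le_trans (wle _) _.
    by rewrite ler_wpM2l.
  by rewrite mulrA ler_piMl // invr_ge0.
- rewrite braketZl normrM norm_conjC exprMn sg2 wE.
  have -> : \sum_n (a n)^* * braket phi (K n *m psi) = g.
    by rewrite gE; apply: eq_bigr => n _; rewrite normCK mulrC.
  rewrite ger0_norm //.
  have [->|gn0] := eqVneq g 0; first by rewrite expr0n mulr0.
  by rewrite expr2 mulKf.
Qed.

End Converse.

(** * The hypersimplex *)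

Section Hypersimplex.
Variable F : realFieldType.
Implicit Types (D M : nat).

(** Displacement along an edge direction of the hypersimplex. *)
Definition shift D (x : 'I_D -> F) a b t : 'I_D -> F :=
  fun j => x j + t * ((j == a)%:R - (j == b)%:R).

Definition fractional D (x : 'I_D -> F) := [set j | 0 < x j < 1].

Lemma sum_shift D (x : 'I_D -> F) a b t : \sum_j shift x a b t j = \sum_j x j.
Proof.
rewrite big_split /= -mulr_sumr sumrB.
have E c : \sum_(j : 'I_D) (j == c)%:R = 1 :> F.
  by rewrite (bigD1 c) //= eqxx big1 ?addr0 // => j /negPf ->.
by rewrite !E subrr mulr0 addr0.
Qed.

(** The step is the largest one that stays in the cube: at its end coordinate a has reached 1 or
    coordinate b has reached 0, and no other coordinate has moved. *)
Lemma shift_fractional D (x : 'I_D -> F) a b : a != b ->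
    a \in fractional x -> b \in fractional x -> (forall j, 0 <= x j <= 1) ->
  exists2 t, 0 < t & (forall j, 0 <= shift x a b t j <= 1) /\
    (#|fractional (shift x a b t)| < #|fractional x|)%N.
Proof.
move=> ab fa fb x01.
have := fa; have := fb; rewrite !inE => /andP[b0 b1] /andP[a0 a1].
pose t := Num.min (1 - x a) (x b).
have ta : t <= 1 - x a by rewrite ge_min lexx.
have tb : t <= x b by rewrite ge_min lexx orbT.
have t0 : 0 < t by rewrite lt_min subr_gt0 a1.
have sa : shift x a b t a = x a + t.
  by rewrite /shift eqxx (negPf ab) subr0 mulr1.
have sb : shift x a b t b = x b - t.
  by rewrite /shift eqxx eq_sym (negPf ab) sub0r mulrN1.
have sj j : j != a -> j != b -> shift x a b t j = x j.
  by rewrite /shift => /negPf-> /negPf->; rewrite subrr mulr0 addr0.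
exists t => //; split.
  move=> j; have [->|ja] := eqVneq j a; first by rewrite sa; apply/andP; split; lra.
  have [->|jb] := eqVneq j b; first by rewrite sb; apply/andP; split; lra.
  by rewrite sj.
apply: proper_card; apply/properP; split.
  apply/fintype.subsetP => j; have [-> //|ja] := eqVneq j a.
  by have [-> //|jb] := eqVneq j b; rewrite !inE sj.
have [le|lt] := leP (1 - x a) (x b); [exists a|exists b] => //; rewrite inE.
  by rewrite sa /t (min_idPl le); apply/negP => /andP[_]; lra.
by rewrite sb /t (min_idPr (ltW lt)); apply/negP => /andP[]; lra.
Qed.

(** Were [a] the only fractional coordinate, the others would sum to an integer k, and M - k would
    be an integer strictly between 0 and 1. *)
Lemma fractional_neq1 D M (x : 'I_D -> F) a : (forall j, 0 <= x j <= 1) ->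
  \sum_j x j = M%:R -> a \in fractional x ->
  exists2 b, a != b & b \in fractional x.
Proof.
move=> x01 sx; rewrite inE => /andP[a0 a1].
have [/existsP[b /andP[]]|/existsPn nob] :=
  boolP [exists b, (a != b) && (b \in fractional x)]; first by exists b.
suff [k sk] : exists k : nat, \sum_(j | j != a) x j = k%:R.
  move: sx; rewrite (bigD1 a) //= sk => sx.
  have : (k < M)%N by rewrite -(ltr_nat F); lra.
  rewrite -(ler_nat F) -natr1; lra.
exists (\sum_(j | j != a) (x j == 1%R))%N; rewrite natr_sum; apply: eq_bigr => j ja.
have := nob j; rewrite eq_sym ja inE /=; have /andP[] := x01 j.
rewrite le_eqVlt => /predU1P[<-|->]; first by rewrite eq_sym oner_eq0.
by rewrite le_eqVlt => /predU1P[->|->] //; rewrite eqxx.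
Qed.

(** For injective [f] this is the indicator of the image of [f], a vertex of the hypersimplex. *)
Definition incidence D M (f : {ffun 'I_M -> 'I_D}) (j : 'I_D) : F :=
  \sum_m (f m == j)%:R.

(* The vertices of the hypersimplex are the indicators of M-subsets; they are
   enumerated here by injections, which also number the elements. *)
Lemma hypersimplex_decomposition D M (x : 'I_D -> F) :
  (forall j, 0 <= x j <= 1) -> \sum_j x j = M%:R ->
  exists w : {ffun 'I_M -> 'I_D} -> F,
    [/\ forall f, 0 <= w f, \sum_f w f = 1,
        forall f, w f != 0 -> injective f &
        forall j, \sum_f w f * incidence f j = x j].
Proof.
(* Induction on the number of fractional coordinates; a point without any is itself a vertex. *)
have [n] := ubnP #|fractional x|; elim: n x => // n IHn x /ltnSE le_n x01 sx.
have [f0|[a fa]] := set_0Vmem (fractional x).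
  have x1 j : x j = (x j == 1)%:R.
    have : j \notin fractional x by rewrite f0 inE.
    rewrite inE; have /andP[] := x01 j.
    rewrite le_eqVlt => /predU1P[<-|->]; first by rewrite eq_sym oner_eq0.
    by rewrite le_eqVlt => /predU1P[->|->] //; rewrite eqxx.
  pose S := [set j | x j == 1].
  have cS : M = #|S|.
    apply/eqP; rewrite -(eqr_nat F) -sx; apply/eqP.
    rewrite -sum1_card natr_sum [RHS]big_mkcond /=; apply: eq_bigr => j _.
    by rewrite {1}x1 inE; case: (x j == 1).
  pose f : {ffun 'I_M -> 'I_D} := [ffun m => enum_val (cast_ord cS m)].
  have fE m : f m = enum_val (cast_ord cS m) by rewrite ffunE.
  have injf : injective f.
    by move=> m m'; rewrite !fE => /enum_val_inj /cast_ord_inj.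
  exists (fun g => (g == f)%:R); split => //.
  - by rewrite (bigD1 f) //= eqxx big1 ?addr0 // => g /negPf ->.
  - by move=> g; have [-> //|_] := eqVneq g f; rewrite eqxx.
  move=> j; rewrite (bigD1 f) //= eqxx mul1r big1 ?addr0; last first.
    by move=> g /negPf ->; rewrite mul0r.
  rewrite /incidence x1; have [jS|jS] := eqVneq (x j) 1.
    have jS' : j \in S by rewrite inE jS.
    pose m0 := cast_ord (esym cS) (enum_rank_in jS' j).
    have fm0 : f m0 = j by rewrite fE /m0 cast_ordKV enum_rankK_in.
    rewrite (bigD1 m0) //= fm0 eqxx big1 ?addr0 // => m mm0.
    by rewrite -fm0 (inj_eq injf) (negPf mm0).
  rewrite big1 // => m _; case: eqP => // fj.
  by have := enum_valP (cast_ord cS m); rewrite -fE fj inE (negPf jS).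
have [b ab fb] := fractional_neq1 x01 sx fa.
have [t t0 [y01 yn]] := shift_fractional ab fa fb x01.
have ba : b != a by rewrite eq_sym.
have [s s0 [z01 zn]] := shift_fractional ba fb fa x01.
have sy : \sum_j shift x a b t j = M%:R by rewrite sum_shift.
have sz : \sum_j shift x b a s j = M%:R by rewrite sum_shift.
have [w1 [w1p w1s w1i w1x]] := IHn _ (leq_trans yn le_n) y01 sy.
have [w2 [w2p w2s w2i w2x]] := IHn _ (leq_trans zn le_n) z01 sz.
have st0 : 0 < s + t by rewrite addr_gt0.
(* The displacements t and s are opposite, so x = (s y + t z) / (s + t) for the two shifted points y
   and z. *)
exists (fun f => (s * w1 f + t * w2 f) / (s + t)); split.
- move=> f; apply: divr_ge0; last exact: ltW.
  by rewrite addr_ge0 // mulr_ge0 // ltW.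
- by rewrite -mulr_suml big_split /= -!mulr_sumr w1s w2s !mulr1 divff // gt_eqF.
- move=> f; have [w10|w1n _] := eqVneq (w1 f) 0; last exact: w1i.
  have [w20|w2n _] := eqVneq (w2 f) 0; last exact: w2i.
  by rewrite w10 w20 !mulr0 addr0 mul0r eqxx.
move=> j.
under eq_bigr => f _ do rewrite mulrAC mulrDl -!mulrA.
rewrite -mulr_suml big_split /= -!mulr_sumr w1x w2x /shift.
by field; rewrite gt_eqF.
Qed.

End Hypersimplex.

(** * From flat vectors to incoherent operations *)

Section Achievability.
Variable R : realType.
Local Notation C := R[i].
Local Open Scope complex_scope.

(** By the second hypothesis each column of [K t] has at most one nonzero entry, so basis vectors go
    to multiples of basis vectors and diagonal matrices stay diagonal; the first gives trace
    preservation. *)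
Lemma incoherent_operation_Kraus (T : finType) d d' (K : T -> 'M[C]_(d', d)) :
  \sum_t (K t) ^t* *m K t = 1%:M ->
  (forall t a b j, a != b -> K t a j * K t b j = 0) ->
  incoherent_operation (fun X => \sum_t K t *m X *m (K t) ^t*).
Proof.
move=> K1 Kinc; split.
  move=> X; rewrite -[X in _ = \tr X]mul1mx -K1 mulmx_suml !raddf_sum /=.
  by apply: eq_bigr => t _; rewrite mxtrace_mulC mulmxA.
exists #|T|, (fun n => K (enum_val n)); split.
  by move=> X; rewrite (sum_enum_val (fun t => K t *m X *m (K t) ^t*)).
move=> n tau [_ /is_diag_mxP dtau]; apply/is_diag_mxP => a b ab.
rewrite mxE big1 // => j _; rewrite mxE big_distrl big1 //= => k _.
have [->|kj] := eqVneq k j; last by rewrite dtau // mulr0 mul0r.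
rewrite !mxE mulrAC; have /eqP := Kinc (enum_val n) a b j ab.
by rewrite mulf_eq0 => /orP[]/eqP-> ; rewrite ?conjC0 ?mulr0 !mul0r.
Qed.

Lemma Re_normC2 (z : C) : (complex.Re (`|z| ^+ 2))%:C = `|z| ^+ 2.
Proof. by rewrite RRe_real // ger0_real // exprn_ge0. Qed.

(** For an M-set of weight w_f, [Kf f] relabels coordinate f(m) as m and divides by v there, turning
    v into sqrt(w_f) Phi_M. Since the weights of the sets containing j add up to M |v_j|^2, these
    operators are complete wherever v_j is nonzero. *)
Lemma flat_unit_Kraus D M (v : 'cV[C]_D) : (0 < M)%N -> braket v v = 1 ->
  (forall j, `|v j 0| ^+ 2 <= M%:R^-1) ->
  exists (T : finType) (K : T -> 'M[C]_(M, D)) (c : T -> C),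
    [/\ \sum_t (K t) ^t* *m K t = 1%:M,
        forall t a b j, a != b -> K t a j * K t b j = 0,
        forall t, K t *m v = c t *: Phi R M M &
        \sum_t `|c t| ^+ 2 = 1].
Proof.
move=> M0 v1 vM.
have MR0 : 0 < M%:R :> R by rewrite ltr0n.
pose x j : R := M%:R * complex.Re (`|v j 0| ^+ 2).
have xE j : (x j)%:C = M%:R * `|v j 0| ^+ 2.
  by rewrite /x rmorphM /= Re_normC2 rmorph_nat.
have x01 j : 0 <= x j <= 1.
  rewrite -!lecR xE mulr_ge0 ?exprn_ge0 ?ler0n //=.
  apply: (@le_trans _ _ (M%:R * M%:R^-1)); first by rewrite ler_wpM2l.
  by rewrite divff // pnatr_eq0 -lt0n.
have sx : \sum_j x j = M%:R.
  apply: (@complexI R); rewrite rmorph_sum rmorph_nat /=.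
  under eq_bigr do rewrite xE.
  by rewrite -mulr_sumr -braket_sqr v1 mulr1.
have [w [w0 w1 winj wx]] := hypersimplex_decomposition x01 sx.
pose s f : C := (Num.sqrt (w f) / Num.sqrt M%:R)%:C.
have s2 f : `|s f| ^+ 2 = (w f)%:C / M%:R.
  rewrite normCr -rmorphXn /= real_normK ?num_real // exprMn exprVn !sqr_sqrtr ?ler0n //.
  by rewrite rmorphM /= fmorphV rmorph_nat.
(* Division by a zero entry of [v] gives 0, which would drop a component of Phi_M. Such [f] have
   weight 0, since M |v_j|^2 = 0 is a sum of nonnegative terms. *)
have s0 : forall (f : {ffun 'I_M -> 'I_D}) m, v (f m) 0 = 0 -> s f = 0.
  move=> f m vf; suff w00 : w f = 0 by rewrite /s w00 sqrtr0 mul0r.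
  have i0 g j : 0 <= incidence R g j by rewrite sumr_ge0.
  have : x (f m) = 0 by rewrite /x vf normr0 expr0n mulr0.
  rewrite -wx => /eqP; rewrite psumr_eq0; last by move=> g _; rewrite mulr_ge0.
  move=> /allP/(_ f); rewrite mem_index_enum => /(_ isT).
  rewrite /= mulf_eq0 => /orP[/eqP //|].
  rewrite psumr_eq0 // => /allP/(_ m).
  by rewrite mem_index_enum eqxx oner_eq0 => /(_ isT).
pose Kf (f : {ffun 'I_M -> 'I_D}) : 'M[C]_(M, D) :=
  \matrix_(m, j) if f m == j then s f / v j 0 else 0.
(* These send to |0> the basis vectors orthogonal to v. *)
pose Kj (k : 'I_D) : 'M[C]_(M, D) :=
  \matrix_(m, j) if [&& (m == 0 :> nat)%N, j == k & v j 0 == 0] then 1 else 0.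
exists ({ffun 'I_M -> 'I_D} + 'I_D)%type,
  (fun t => match t with inl f => Kf f | inr k => Kj k end),
  (fun t => match t with inl f => (Num.sqrt (w f))%:C | inr k => 0 end).
split.
- apply/matrixP => j j'; rewrite summxE big_sumType /= mxE.
  under eq_bigr => f _ do rewrite mxE.
  under [X in _ + X]eq_bigr => k _ do rewrite mxE.
  have [<-|jj'] := eqVneq j j'; last first.
    rewrite big1 => [|f _]; last first.
      rewrite big1 // => m _; rewrite !mxE; case: eqP => [->|]; last first.
        by rewrite conjC0 mul0r.
      by rewrite (negPf jj') mulr0.
    rewrite add0r big1 // => k _; rewrite big1 // => m _; rewrite !mxE.
    have [jk|] := eqVneq j k; last by rewrite andbF conjC0 mul0r.
    by rewrite -jk [j' == j]eq_sym (negPf jj') andbF mulr0.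
  (* [E1] evaluates to 1 where v_j is nonzero and to 0 elsewhere; [E2] supplies the complement. *)
  have E1 : \sum_f \sum_m ((Kf f) ^t*) j m * Kf f m j =
      (x j)%:C / M%:R / `|v j 0| ^+ 2.
    rewrite -wx rmorph_sum !mulr_suml; apply: eq_bigr => f _.
    rewrite rmorphM rmorph_sum /= mulr_sumr !mulr_suml; apply: eq_bigr => m _.
    rewrite !mxE; case: eqP => _; last by rewrite conjC0 mul0r rmorph0 mulr0 !mul0r.
    by rewrite mulrC -normCK normrM exprMn s2 normfV exprVn rmorph1 mulr1.
  have E2 : \sum_k \sum_m ((Kj k) ^t*) j m * Kj k m j = (v j 0 == 0)%:R.
    rewrite (bigD1 j) //= [X in _ + X]big1 ?addr0 => [|k kj]; last first.
      by rewrite big1 // => m _; rewrite !mxE [j == k]eq_sym (negPf kj) andbF mulr0.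
    rewrite (bigD1 (Ordinal M0)) //= big1 ?addr0 => [|m m0]; last first.
      by rewrite !mxE; move: m0; rewrite -val_eqE /= => /negPf->; rewrite mulr0.
    by rewrite !mxE eqxx /=; case: ifP => _; rewrite ?mulr0 // conjC1 mulr1.
  rewrite E1 E2 xE.
  have [->|vn0] := eqVneq (v j 0) 0.
    by rewrite normr0 expr0n invr0 mulr0 add0r.
  by rewrite addr0 mulrAC mulfK ?expf_eq0 ?normr_eq0 // divff ?eqxx // pnatr_eq0 -lt0n.
- move=> [f|k] a b j ab; rewrite !mxE.
    case: eqP => [fa|_]; last by rewrite mul0r.
    case: eqP => [fb|_]; last by rewrite mulr0.
    (* Either the operator vanishes, or [f] is injective and two rows cannot share the column j. *)
    have [wf|wf] := eqVneq (w f) 0; first by rewrite /s wf sqrtr0 !mul0r.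
    by move: ab; rewrite (winj f wf a b) ?fa ?eqxx // fb.
  have [a0|_] := eqVneq (a : nat) 0%N; last by rewrite mul0r.
  have [b0|_] := eqVneq (b : nat) 0%N; last by rewrite mulr0.
  by move: ab; rewrite -val_eqE /= a0 b0.
- move=> [f|k]; apply/matrixP => m z; rewrite (ord1 z) !mxE /=.
    rewrite ltn_ord (bigD1 (f m)) //= big1 ?addr0 => [|j jm]; last first.
      by rewrite mxE eq_sym (negPf jm) mul0r.
    rewrite mxE eqxx /s rmorphM /=.
    have [vf|vf] := eqVneq (v (f m) 0) 0; last by rewrite divfK.
    by have := s0 f m vf; rewrite /s rmorphM /= => ->; rewrite vf mulr0.
  rewrite mul0r big1 // => j _; rewrite mxE.
  by have [->|_] := eqVneq (v j 0) 0; rewrite ?mulr0 // !andbF mul0r.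
rewrite big_sumType /= [X in _ + X]big1 ?addr0; last by move=> *; rewrite normr0 expr0n.
rewrite -[RHS](rmorph1 (real_complex R)) -w1 rmorph_sum; apply: eq_bigr => f _ /=.
by rewrite normCr -rmorphXn /= real_normK ?num_real // sqr_sqrtr.
Qed.

(** The missing norm 1 - |u|^2 is spread evenly over M new coordinates, each of weight at most
    1/M. *)
Lemma flat_extension M d (u : 'cV[C]_d) : (0 < M)%N -> flat M u ->
  exists2 v : 'cV[C]_(d + M), braket v v = 1 /\ usubmx v = u &
    forall j, `|v j 0| ^+ 2 <= M%:R^-1.
Proof.
move=> M0 [u1 uM]; pose r := (1 - braket u u) / M%:R.
have M0C : 0 < M%:R :> C by rewrite ltr0n.
have r0 : 0 <= r by rewrite divr_ge0 ?subr_ge0 // ltW.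
have sr2 : `|sqrtC r| ^+ 2 = r by rewrite ger0_norm ?sqrtC_ge0 // sqrtCK.
exists (col_mx u (const_mx (sqrtC r))); first split.
- rewrite braket_col_mx [X in _ + X]braket_sqr.
  under eq_bigr do rewrite mxE sr2.
  by rewrite sumr_const card_ord -[r *+ M]mulr_natr divfK ?gt_eqF // addrC subrK.
- exact: col_mxKu.
move=> j; case: (splitP j) => [k jk|k jk].
  have -> : j = lshift M k by apply: val_inj.
  by rewrite col_mxEu.
have -> : j = rshift d k by apply: val_inj.
rewrite col_mxEd mxE sr2 /r ler_piMl ?invr_ge0 ?ler0n // gerBl.
exact: braket_ge0.
Qed.

(** The Kraus operators of a unit completion v of u are cut down to the first d columns.
    Completeness gives <u|psi> = sum_t conj(c_t) <Phi_M|K'_t psi>, and Cauchy-Schwarz with sum_t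
    |c_t|^2 = 1 concludes. *)
Lemma flat_incoherent_operation M d (u : 'cV[C]_d) : (0 < M)%N -> flat M u ->
  exists2 L : 'M[C]_d -> 'M[C]_M, incoherent_operation L &
    forall psi, `|braket u psi| ^+ 2 <=
      braket (Phi R M M) (L (ketbra psi) *m Phi R M M).
Proof.
move=> M0 fu; have [v [v1 vu] vM] := flat_extension M0 fu.
have [T [K [c [K1 Kinc Kv c1]]]] := flat_unit_Kraus M0 v1 vM.
pose K' t := lsubmx (K t).
have K'inc t a b j : a != b -> K' t a j * K' t b j = 0.
  by move=> ab; rewrite !mxE Kinc.
have K'E t psi : K' t *m psi = K t *m col_mx psi 0.
  by rewrite -[K t]hsubmxK mul_row_col mulmx0 addr0.
exists (fun X => \sum_t K' t *m X *m (K' t) ^t*).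
  apply: incoherent_operation_Kraus => //.
  apply/matrixP => j k.
  have -> : 1%:M j k = (1%:M : 'M[C]_(d + M)) (lshift M j) (lshift M k).
    by rewrite !mxE (inj_eq (@lshift_inj _ _)).
  rewrite -K1 !summxE.
  apply: eq_bigr => t _; rewrite !mxE; apply: eq_bigr => m _.
  by rewrite !mxE.
move=> psi; rewrite mulmx_suml braket_sumr.
under eq_bigr do rewrite mulmx_ketbra braket_ketbra.
have -> : braket u psi = \sum_t (c t)^* * braket (Phi R M M) (K' t *m psi).
  have -> : braket u psi = braket v (col_mx psi 0).
    by rewrite -[v]vsubmxK vu braket_col_mx [X in _ + X]/braket mulmx0 mxE addr0.
  rewrite -[col_mx psi 0]mul1mx -K1 mulmx_suml braket_sumr.
  by apply: eq_bigr => t _; rewrite -mulmxA braket_mulmx adjmxK Kv K'E braketZl.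
by apply: le_trans (sum_CauchySchwarz _ _) _; rewrite c1 mul1r.
Qed.

End Achievability.

(** * Min-entropy, smoothing and concentration *)

Section Smoothing.
Variable R : realType.
Local Notation C := R[i].
Local Open Scope complex_scope.
Local Open Scope classical_set_scope.

(** * Logarithms and the min-entropy of dephased pure states *)

Lemma ler_log2 (a b : R) : 0 < a -> 0 < b -> (log2 a <= log2 b) = (a <= b).
Proof.
move=> a0 b0; rewrite ler_pM2r ?invr_gt0 ?ln_gt0 ?ltr1n //.
by rewrite ler_ln // posrE.
Qed.

Lemma log2V (a : R) : 0 < a -> log2 a^-1 = - log2 a.
Proof. by move=> a0; rewrite /log2 lnV ?posrE // mulNr. Qed.

Lemma log2_powR (x : R) : log2 (2 `^ x) = x.
Proof. by rewrite /log2 ln_powR mulfK // gt_eqF // ln_gt0 // ltr1n. Qed.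

Lemma dephase_ketbra d (psi : 'cV[C]_d) :
  dephase (ketbra psi) = diag_mx (\row_j `|psi j 0| ^+ 2).
Proof.
apply/matrixP => a b; rewrite !mxE; case: eqP => [<-|] //=.
by rewrite big_ord1 !mxE -normCK.
Qed.

Lemma eigenvalue_diag (F : fieldType) d (D : 'rV[F]_d) (a : F) :
  reflect (exists j, a = D 0 j) (eigenvalue (diag_mx D) a).
Proof.
apply: (iffP eigenvalueP) => [[v vD v0]|[j ->]].
  have [j vj] : exists j, v 0 j != 0 by apply/rV0Pn.
  exists j; have /rowP/(_ j) := vD; rewrite mul_mx_diag !mxE mulrC.
  by move=> /(mulIf vj).
exists (delta_mx 0 j); last first.
  by apply/eqP => /rowP/(_ j); rewrite !mxE !eqxx => /eqP; rewrite oner_eq0.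
apply/rowP => k; rewrite mul_mx_diag !mxE eqxx /= mulrC.
by have [->|] := eqVneq k j; rewrite // !mulr0.
Qed.

(** The eigenvalues are the |psi_j|^2. Unit norm bounds them by 1 and forbids d = 0, so the supremum
    is over a nonempty bounded set. *)
Lemma lambda_max_le d (psi : 'cV[C]_d) (c : R) : unit_vector psi ->
  lambda_max (dephase (ketbra psi)) <= c <-> forall j, `|psi j 0| ^+ 2 <= c%:C.
Proof.
move=> psi1; set S := [set x : R | eigenvalue (dephase (ketbra psi)) x%:C].
have inS j : S (complex.Re (`|psi j 0| ^+ 2)).
  rewrite /S /= Re_normC2 dephase_ketbra; apply/eigenvalue_diag.
  by exists j; rewrite mxE.
have psi_sum : \sum_j `|psi j 0| ^+ 2 = 1 by rewrite -braket_sqr.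
have psi_le1 j : `|psi j 0| ^+ 2 <= 1.
  by rewrite -psi_sum (bigD1 j) //= lerDl sumr_ge0 // => k _; rewrite exprn_ge0.
have S_bound (b : R) : (forall j, `|psi j 0| ^+ 2 <= b%:C) -> ubound S b.
  move=> bP x; rewrite /S /= dephase_ketbra => /eigenvalue_diag[j].
  by rewrite mxE => xE; rewrite -lecR xE.
split=> [le j|le].
  rewrite -Re_normC2 lecR; apply: le_trans le.
  by apply: (ub_le_sup _ (inS j)); exists 1; apply: S_bound.
apply: ge_sup; last exact: S_bound.
have [j _|d0] := pickP (fun _ : 'I_d => true).
  by exists (complex.Re (`|psi j 0| ^+ 2)); apply: inS.
have := psi_sum; rewrite big_pred0 => [/eqP|j]; last by have := d0 j.
by rewrite eq_sym oner_eq0.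
Qed.

Lemma Smin_ge d (psi : 'cV[C]_d) (c : R) : unit_vector psi -> 0 < c ->
  - log2 c <= Smin (dephase (ketbra psi)) <->
  forall j, `|psi j 0| ^+ 2 <= c%:C.
Proof.
move=> psi1 c0; rewrite -lambda_max_le // /Smin lerN2 ler_log2 //.
(* Comparing logarithms requires a positive [lambda_max]; otherwise every entry of [psi] would
   vanish. *)
rewrite ltNge; apply/negP => /(lambda_max_le 0 psi1).1 psi0.
have /eqP := psi1; rewrite -[X in X == _]/(braket psi psi) braket_sqr big1.
  by rewrite eq_sym oner_eq0.
by move=> j _; apply/eqP; rewrite eq_le psi0 exprn_ge0.
Qed.

(** Ensures that the infimum in [Fmin] is over a nonempty set. *)
Lemma ensemble_inhabited n d (E : pure_ensemble R n d) : exists i : 'I_n, True.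
Proof.
have [i _|n0] := pickP (fun _ : 'I_n => true); first by exists i.
have := prob_sum1 E; rewrite big_pred0 => [/eqP|j]; last by have := n0 j.
by rewrite eq_sym oner_eq0.
Qed.

Lemma Fmin_ge n d (E : pure_ensemble R n d) (c : R) : 0 < c ->
  - log2 c <= Fmin E <-> forall i j, `|ket E i j 0| ^+ 2 <= c%:C.
Proof.
move=> c0; have E1 i := ket_unit E i.
have [i0 _] := ensemble_inhabited E.
split=> [le i|le].
  apply/(Smin_ge (E1 i) c0); apply: (le_trans le); apply: ge_inf; last by exists i.
  (* The infimum is over a set bounded below by 0 = - log2 1, since entries of unit vectors have
     modulus at most 1. *)
  exists 0 => _ [k _ <-]; rewrite -[leLHS]oppr0.
  have -> : (0 : R) = log2 1 by rewrite /log2 ln1 mul0r.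
  apply/(Smin_ge (E1 k) ltr01) => j.
  have := E1 k; rewrite rmorph1 /unit_vector -[LHS]/(braket _ _) braket_sqr => <-.
  by rewrite (bigD1 j) //= lerDl sumr_ge0 // => l _; rewrite exprn_ge0.
apply: lb_le_inf; first by exists (Smin (dephase (ketbra (ket E i0)))); exists i0.
by move=> _ [i _ <-]; apply/(Smin_ge (E1 i) c0).
Qed.

Definition overlap d (u v : 'cV[C]_d) : R := complex.Re (`|braket u v| ^+ 2).

Lemma overlapE d (u v : 'cV[C]_d) : (overlap u v)%:C = `|braket u v| ^+ 2.
Proof. exact: Re_normC2. Qed.

Lemma overlap_embed d k (v : 'cV[C]_(d + k)) (psi : 'cV[C]_d) : unit_vector psi ->
  fidelity (ketbra v) (ketbra (embed k psi)) ^+ 2 = overlap (usubmx v) psi.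
Proof.
move=> psi1.
have E u : braket (embed k psi) u = braket psi (usubmx u).
  rewrite -[u in LHS]vsubmxK braket_col_mx [X in _ + X]/braket trmx0 map_mx0 mul0mx.
  by rewrite mxE addr0.
apply: (@complexI R); rewrite fidelity_ketbra.
  by rewrite overlapE E normC_braketC.
by rewrite /unit_vector -[LHS]/(braket _ _) E col_mxKu.
Qed.

Lemma overlap_le1 d (u v : 'cV[C]_d) : braket u u <= 1 -> braket v v = 1 ->
  overlap u v <= 1.
Proof.
move=> u1 v1; rewrite -lecR overlapE.
by apply: le_trans (braket_CauchySchwarz u v) _; rewrite v1 mulr1.
Qed.

(** * Flat vectors, smoothing and concentration for one ensemble *)

Section Ensemble.
Variables (n d : nat) (E : pure_ensemble R n d).
Local Notation p := (prob E).
Local Notation psi := (ket E).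

(** Completing each [u i] to a unit vector in dimension d + M keeps its overlap with the zero-padded
    state, so the completions form an ensemble in the ball. *)
Lemma smoothed_Fmin_ge M (eps : R) (u : 'I_n -> 'cV[C]_d) : (0 < M)%N ->
  (forall i, flat M (u i)) -> 1 - eps <= \sum_i p i * overlap (u i) (psi i) ->
  ((log2 M%:R)%:E <= smoothed_Fmin E eps)%E.
Proof.
move=> M0 uM le; have MR0 : 0 < M%:R :> R by rewrite ltr0n.
have /choice[v vP] : forall i, exists v : 'cV[C]_(d + M),
    [/\ unit_vector v, usubmx v = u i & forall j, `|v j 0| ^+ 2 <= M%:R^-1].
  by move=> i; have [v [v1 vu] vM] := flat_extension M0 (uM i); exists v.
have v1 i : unit_vector (v i) by have [] := vP i.
pose E' := PureEnsemble (prob_ge0 E) (prob_sum1 E) v1.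
apply: (@le_trans _ _ (Fmin E')%:E); last first.
  apply: ereal_sup_ubound; exists M, E'; split=> //; split=> //.
  apply: (le_trans le); apply: ler_sum => i _.
  by rewrite (overlap_embed _ (ket_unit E i)) /=; have [_ -> _] := vP i.
rewrite lee_fin -[log2 _]opprK -log2V //; apply/Fmin_ge; first by rewrite invr_gt0.
by move=> i j; rewrite fmorphV rmorph_nat /=; have [_ _] := vP i.
Qed.

Lemma fidelity_mixture d' M (L : 'I_n -> 'M[C]_d -> 'M[C]_d') :
  (0 < M)%N -> (M <= d')%N -> (forall i, incoherent_operation (L i)) ->
  ((fidelity (\sum_i (p i)%:C *: L i (ketbra (psi i))) (ketbra (Phi R d' M))) ^+ 2)%:C
  = \sum_i (p i)%:C *
      braket (Phi R d' M) (L i (ketbra (psi i)) *m Phi R d' M).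
Proof.
move=> M0 Md Linc.
have E1 : braket (Phi R d' M) ((\sum_i (p i)%:C *: L i (ketbra (psi i))) *m Phi R d' M)
  = \sum_i (p i)%:C * braket (Phi R d' M) (L i (ketbra (psi i)) *m Phi R d' M).
  rewrite mulmx_suml braket_sumr; apply: eq_bigr => i _.
  by rewrite -scalemxAl braketZr.
rewrite fidelity_pure //; first exact: Phi_unit.
rewrite E1 sumr_ge0 // => i _; rewrite mulr_ge0 // ?ler0c ?(prob_ge0 E) //.
by have [u _ ->] := incoherent_flat (psi i) (Linc i) M0 Md; rewrite exprn_ge0.
Qed.

(** The supremum in [smoothed_Fmin] need not be attained. For c < 1 an ensemble with [Fmin] above
    log2 (cM) is taken; its truncated vectors scaled by sqrt c are flat for M, at the cost of a
    factor c in the squared fidelity. Then c tends to 1. *)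
Lemma concentration_ge M (eps : R) : 0 <= eps -> (0 < M)%N ->
  ((log2 M%:R)%:E <= smoothed_Fmin E eps)%E ->
  ((log2 M%:R)%:E <= coherence_concentration E eps)%E.
Proof.
move=> eps0 M0 le; apply: ereal_sup_ubound; exists M; split=> //.
have MR0 : 0 < M%:R :> R by rewrite ltr0n.
set S := (X in ereal_sup X).
suff scaled (c : R) : 0 < c < 1 -> ((c * (1 - eps))%:E <= ereal_sup S)%E.
  (* The cap 1/2 keeps c = 1 - m positive; (1 - m)(1 - eps) >= 1 - eps - e follows from eps >= 0 and
     m <= e. *)
  apply/lee_subgt0Pr => e e0; pose m := Num.min e (1 / 2).
  have m0 : 0 < m by rewrite lt_min e0 /=; lra.
  have me : m <= e by rewrite ge_min lexx.
  have m1 : m <= 1 / 2 by rewrite ge_min lexx orbT.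
  apply: le_trans (scaled (1 - m) _); last by apply/andP; split; lra.
  by rewrite -EFinB lee_fin; nra.
move=> /andP[c0 c1].
have cM : 0 < c * M%:R by rewrite mulr_gt0.
have : ((log2 (c * M%:R))%:E < smoothed_Fmin E eps)%E.
  apply: lt_le_trans le; rewrite lte_fin ltNge ler_log2 // -ltNge.
  by rewrite gtr_pMl.
move=> /ereal_sup_gt[_ [k [E' [[pE' ball] ->]]]]; rewrite lte_fin => /ltW.
rewrite -[log2 _]opprK -log2V // => /Fmin_ge; rewrite invr_gt0 => /(_ cM) E'M.
pose s : C := (Num.sqrt c)%:C.
have s2 : `|s| ^+ 2 = c%:C.
  by rewrite normCr ger0_norm ?sqrtr_ge0 // -rmorphXn /= sqr_sqrtr // ltW.
pose u i := s *: usubmx (ket E' i).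
have uM i : flat M (u i).
  split.
    rewrite braketZl braketZr mulrA -[_ * s]mulrC -normCK s2.
    have := ket_unit E' i; rewrite /unit_vector -[LHS]/(braket _ _).
    rewrite -[ket E' i]vsubmxK braket_col_mx col_mxKu => <-.
    apply: (@le_trans _ _ (braket (usubmx (ket E' i)) (usubmx (ket E' i)))).
      by rewrite ler_piMl ?braket_ge0 // lecR ltW.
    by rewrite lerDl braket_ge0.
  move=> j; rewrite !mxE normrM exprMn s2.
  apply: (@le_trans _ _ (c%:C * (c * M%:R)^-1%:C)).
    by apply: ler_wpM2l; [rewrite ler0c ltW | exact: E'M].
  by rewrite -rmorphM /= invfM mulVKf ?gt_eqF // fmorphV rmorph_nat.
have /choice[L LP] : forall i, exists L : 'M[C]_d -> 'M[C]_M,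
    incoherent_operation L /\ forall phi, `|braket (u i) phi| ^+ 2 <=
      braket (Phi R M M) (L (ketbra phi) *m Phi R M M).
  by move=> i; have [L ? ?] := flat_incoherent_operation M0 (uM i); exists L.
have Linc i : incoherent_operation (L i) by have [] := LP i.
apply: le_trans (ereal_sup_ubound _); last by exists M, L; split.
rewrite lee_fin -lecR fidelity_mixture //.
apply: (@le_trans _ _ (c * \sum_i p i * overlap (usubmx (ket E' i)) (psi i))%:C).
  rewrite lecR ler_pM2l //; apply: (le_trans ball); apply: ler_sum => i _.
  by rewrite (overlap_embed _ (ket_unit E i)).
rewrite mulr_sumr rmorph_sum; apply: ler_sum => i _ /=.
rewrite mulrCA rmorphM /= ler_wpM2l ?ler0c ?(prob_ge0 E) //.
have [_ Li] := LP i; apply: le_trans (Li _).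
by rewrite rmorphM /= overlapE braketZl normrM norm_conjC exprMn s2.
Qed.

(** The slack [eta] pays for a supremum over operations that may not be attained; a near-optimal
    family gives one flat vector per state. *)
Lemma concentration_flat M (eps eta : R) : (0 < M)%N -> 0 < eta ->
  ((1 - eps)%:E <= ereal_sup [set f : \bar R | exists (d' : nat)
     (L : 'I_n -> 'M[R[i]]_d -> 'M[R[i]]_d'),
   [/\ (M <= d')%N, forall i, incoherent_operation (L i) &
     f = ((fidelity (\sum_(i < n) (prob E i)%:C *: L i (ketbra (ket E i)))
             (ketbra (Phi R d' M))) ^+ 2)%:E]])%E ->
  exists2 u : 'I_n -> 'cV[C]_d, forall i, flat M (u i) &
    1 - (eps + eta) <= \sum_i p i * overlap (u i) (psi i).
Proof.
move=> M0 eta0 le.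
have : ((1 - (eps + eta))%:E < (1 - eps)%:E)%E by rewrite lte_fin; lra.
move=> /lt_le_trans/(_ le)/ereal_sup_gt[_ [d' [L [Md Linc ->]]]].
rewrite lte_fin => /ltW lef.
have /choice[u uP] : forall i, exists u, flat M u /\
    braket (Phi R d' M) (L i (ketbra (psi i)) *m Phi R d' M) = `|braket u (psi i)| ^+ 2.
  by move=> i; have [u ? ?] := incoherent_flat (psi i) (Linc i) M0 Md; exists u.
exists u => [i|]; first by have [] := uP i.
apply: (le_trans lef); rewrite -lecR fidelity_mixture // rmorph_sum.
by apply: ler_sum => i _; rewrite rmorphM /= overlapE; have [_ ->] := uP i.
Qed.

End Ensemble.

(** * Stability of flatness and the upper bound *)

(** Write v = a u + r with a = <u|v>. As |u| <= 1, |r|^2 <= 1 - |a|^2 <= kap^2, so |v_j| <= |u_j| +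
    kap; squaring with |u_j|, kap <= 1 costs at most 3 kap. *)
Lemma near_flat M d (u v : 'cV[C]_d) (kap : C) j : flat M u -> braket v v = 1 ->
  0 <= kap <= 1 -> 1 - kap ^+ 2 <= `|braket u v| ^+ 2 ->
  `|v j 0| ^+ 2 <= M%:R^-1 + 3 * kap.
Proof.
move=> [u1 uM] v1 /andP[k0 k1] le; set a := braket u v in le.
have entry_le (x : 'cV[C]_d) (b : C) : 0 <= b -> braket x x <= b ^+ 2 -> `|x j 0| <= b.
  move=> b0 xb; rewrite -(@ler_pXn2r _ 2) // ?nnegrE //; apply: le_trans xb.
  by rewrite braket_sqr (bigD1 j) //= lerDl sumr_ge0.
have a1 : `|a| <= 1.
  rewrite -(@ler_pXn2r _ 2) // ?nnegrE // expr1n.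
  by apply: le_trans (braket_CauchySchwarz u v) _; rewrite v1 mulr1.
have uj : `|u j 0| <= 1 by apply: entry_le => //; rewrite expr1n.
pose r := v - a *: u.
have rr : braket r r = 1 - `|a| ^+ 2 - (1 - braket u u) * `|a| ^+ 2.
  rewrite /r braketBr !braketBl !braketZl !braketZr v1 (braketC u v) -/a normCK.
  by ring.
have rj : `|r j 0| <= kap.
  apply: entry_le => //; rewrite rr.
  apply: (@le_trans _ _ (1 - `|a| ^+ 2)); last by rewrite lerBlDr -lerBlDl.
  by rewrite gerBl mulr_ge0 ?subr_ge0 // exprn_ge0.
have vj : `|v j 0| <= `|u j 0| + kap.
  have -> : v j 0 = a * u j 0 + r j 0 by rewrite /r !mxE; ring.
  by rewrite (le_trans (ler_normD _ _)) // lerD // normrM ler_piMl.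
apply: (@le_trans _ _ ((`|u j 0| + kap) ^+ 2)).
  by rewrite ler_pXn2r // nnegrE // addr_ge0.
have -> : (`|u j 0| + kap) ^+ 2 =
    `|u j 0| ^+ 2 + (2 * (`|u j 0| * kap) + kap * kap) by ring.
apply: lerD; first exact: uM.
have -> : 3 * kap = 2 * (1 * kap) + 1 * kap by ring.
by apply: lerD; [apply: ler_wpM2l => // |]; apply: ler_wpM2r.
Qed.

(** All overlaps are at most 1, so a deficit [eta] of the average bounds p_i times the deficit of
    state i; [near_flat] then applies with arbitrarily small error. *)
Lemma flat_of_near n d (E : pure_ensemble R n d) M i : 0 < prob E i ->
  (forall eta : R, 0 < eta -> exists2 u : 'I_n -> 'cV[C]_d,
     forall k, flat M (u k) &
     1 - eta <= \sum_k prob E k * overlap (u k) (ket E k)) ->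
  flat M (ket E i).
Proof.
move=> pi0 near; split; first by rewrite (ket_unit E i : braket _ _ = 1).
move=> j; rewrite -Re_normC2 -[M%:R](rmorph_nat (real_complex R)).
rewrite -fmorphV lecR; apply/ler_addgt0Pr => e e0.
pose kap := Num.min (e / 3) 1.
have kap0 : 0 < kap by rewrite lt_min ltr01 andbT; lra.
have kap1 : kap <= 1 by rewrite ge_min lexx orbT.
have kape : 3 * kap <= e.
  have : kap <= e / 3 by rewrite ge_min lexx.
  lra.
(* Dividing this [eta] by p_i leaves a deficit kap^2 for state i. *)
have [|u uM le] := near (prob E i * kap ^+ 2); first by rewrite mulr_gt0 // exprn_gt0.
have le1 k : overlap (u k) (ket E k) <= 1.
  by apply: overlap_le1; [have [] := uM k | apply: (ket_unit E k)].
have ui : 1 - kap ^+ 2 <= overlap (u i) (ket E i).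
  rewrite -(ler_pM2l pi0).
  have : \sum_k prob E k * overlap (u k) (ket E k) <=
      prob E i * overlap (u i) (ket E i) + \sum_(k | k != i) prob E k.
    rewrite (bigD1 i) //= lerD2l; apply: ler_sum => k _.
    by rewrite ler_piMr // (prob_ge0 E).
  have := prob_sum1 E; rewrite (bigD1 i) //= => s1.
  by move: le; lra.
apply: le_trans (_ : M%:R^-1 + 3 * kap <= _); last by rewrite lerD2l.
rewrite -lecR Re_normC2 rmorphD fmorphV rmorphM !rmorph_nat /=.
apply: near_flat (uM i) (ket_unit E i) _ _.
  by rewrite ler0c ltW //= -[1]/((1 : R)%:C) lecR.
by rewrite -overlapE -rmorphXn -[1]/((1 : R)%:C) -rmorphB lecR.
Qed.

Lemma concentration_le n d (E : pure_ensemble R n d) (eps : R) : 0 <= eps ->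
  (coherence_concentration E eps <= smoothed_Fmin E (2 * eps))%E.
Proof.
move=> eps0; apply: ge_ereal_sup => _ [M [M0 le ->]].
have near eta : 0 < eta -> _ := fun eta0 => concentration_flat M0 eta0 le.
have [eps_eq0|eps_neq0] := eqVneq eps 0; last first.
  have [|u uM ule] := near eps; first by rewrite lt_def eps_neq0.
  by apply: (smoothed_Fmin_ge M0 uM); rewrite mulr_natl mulr2n.
subst eps; rewrite mulr0.
(* A state of probability 0 need not be flat; the zero vector is, and its overlap has no weight. *)
pose u i := if prob E i == 0 then 0 else ket E i.
have uM i : flat M (u i).
  rewrite /u; case: eqP => [_|/eqP pi0].
    split=> [|j]; first by rewrite /braket mulmx0 mxE.
    by rewrite mxE normr0 expr0n invr_ge0.
  apply: flat_of_near; first by rewrite lt_def pi0 (prob_ge0 E).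
  by move=> eta eta0; have := near eta eta0; rewrite add0r.
apply: (smoothed_Fmin_ge M0 uM); rewrite subr0 -(prob_sum1 E).
apply: ler_sum => i _; rewrite /u; case: eqP => [->|_]; first by rewrite mul0r.
suff -> : overlap (ket E i) (ket E i) = 1 by rewrite mulr1.
apply: (@complexI R); rewrite overlapE.
by rewrite (ket_unit E i : braket _ _ = 1) normr1 expr1n.
Qed.

(** * Rounding to the logarithm of an integer *)

(** Every unit vector is flat for M = 1, so the given states witness log2 1. This makes rounding
    down to the logarithm of a positive integer possible. *)
Lemma smoothed_Fmin_ge0 n d (E : pure_ensemble R n d) (eps : R) : 0 <= eps ->
  (0 <= smoothed_Fmin E eps)%E.
Proof.
move=> eps0; have -> : 0%E = (log2 (1%:R : R))%:E by rewrite /log2 ln1 mul0r.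
have E1 i : braket (ket E i) (ket E i) = 1 := ket_unit E i.
apply: (@smoothed_Fmin_ge _ _ E 1 eps (ket E)) => // [i|].
  split=> [|j]; first by rewrite E1.
  by rewrite invr1 -(E1 i) braket_sqr (bigD1 j) //= lerDl sumr_ge0.
have -> : \sum_i prob E i * overlap (ket E i) (ket E i) = 1; last by lra.
rewrite -(prob_sum1 E); apply: eq_bigr => i _.
suff -> : overlap (ket E i) (ket E i) = 1 by rewrite mulr1.
by apply: (@complexI R); rewrite overlapE E1 normr1 expr1n.
Qed.

(** N = floor(2^r) is at least 1, so 2^r < N + 1 <= 2N. *)
Lemma log2_floor (r : R) : 0 <= r ->
  exists2 N : nat, (0 < N)%N & 0 <= r - log2 N%:R <= 1.
Proof.
move=> r0; pose N := Num.truncn (2 `^ r : R).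
have P0 : 0 < 2 `^ r :> R by rewrite powR_gt0.
have P1 : 1 <= 2 `^ r :> R.
  by rewrite -ler_log2 // log2_powR /log2 ln1 mul0r.
have /andP[Nle Nlt] := truncn_itv (ltW P0).
have N0 : (0 < N)%N by rewrite -ltnS -(ltr_nat R); apply: le_lt_trans Nlt.
have NR0 : 0 < N%:R :> R by rewrite ltr0n.
have N1 : 1 <= N%:R :> R by rewrite ler1n.
have lN : log2 N%:R <= r by rewrite -[leRHS]log2_powR ler_log2.
have rN : r <= 1 + log2 N%:R.
  have -> : 1 + log2 N%:R = log2 (2 * N%:R) :> R.
    rewrite /log2 lnM ?posrE // mulrDl divff // gt_eqF // ln_gt0 //.
    by rewrite ltr1n.
  rewrite -[leLHS]log2_powR ler_log2 //; last by rewrite mulr_gt0.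
  by move: Nlt; rewrite -natr1 -/N; lra.
by exists N => //; apply/andP; split; lra.
Qed.

End Smoothing.

Theorem theorem2 (R : realType) (n d : nat) (E : pure_ensemble R n d) (eps : R)
    (heps : (0 <= eps)%R) :
  (exists delta : R, rounds_to_log2_integer (smoothed_Fmin E eps) delta) /\
  (forall delta : R, rounds_to_log2_integer (smoothed_Fmin E eps) delta ->
     (smoothed_Fmin E eps - delta%:E <= coherence_concentration E eps)%E /\
     (coherence_concentration E eps <= smoothed_Fmin E (2 * eps)%R)%E).
Proof.
have S0 := smoothed_Fmin_ge0 E heps.
split.
  case S: (smoothed_Fmin E eps) S0 => [r| |] // S0.
    have [N N0 rN] := log2_floor S0; exists (r - log2 N%:R); split=> // _.
    by exists N => //; rewrite -EFinB subKr.
  by exists 0; split; rewrite // lexx ler01.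
move=> delta [/andP[delta0 _] fin]; split; last exact: concentration_le.
have ge := @concentration_ge _ _ _ E _ eps heps.
case S: (smoothed_Fmin E eps) fin S0 ge => [r| |] // fin _ ge.
  have [N N0 rN] := fin isT; rewrite rN; apply: ge => //.
  by rewrite -rN -EFinB lee_fin gerBl.
(* Every log2 N lies below the infinite smoothed value, hence below the concentration, and N can be
   taken above any 2^a. *)
have -> : coherence_concentration E eps = +oo%E; last exact: leey.
apply: eq_infty => a; pose N := (Num.truncn (2 `^ a : R)).+1.
apply: le_trans (ge N isT (leey _)).
rewrite lee_fin -[leLHS]log2_powR ler_log2 ?powR_gt0 // ?ltr0n //.
by have /andP[_ /ltW] := truncn_itv (powR_ge0 (2 : R) a).
Qed.
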